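(* Let $d,s\ge1$ be integers, let $\alpha>0$ be real, and let $\mathcal F_1,\ldots,\mathcal F_{d+1}$ be finite nonempty families of $s$-convex sets in $\mathbb{R}^d$, with $|\mathcal F_i|=n_i$. If at least $\alpha n_1\cdots n_{d+1}$ colorful tuples intersect (have nonempty common intersection), then for some $i\in\{1,\dots,d+1\}$ there is a point contained in at least $\alpha n_i/((d+1)s^d)$ members of $\mathcal F_i$.
   Context: A set in $\mathbb{R}^d$ is called $s$-convex if it is the union of at most $s$ convex sets. A colorful tuple from families $\mathcal F_1,\ldots,\mathcal F_{d+1}$ is a tuple $(F_1,\dots,F_{d+1})$ consisting of one member $F_i\in\mathcal F_i$ of each family. *)

(* Defs.v *)
From mathcomp Require Import all_boot all_order all_algebra.
From mathcomp Require Import all_classical all_reals.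
From mathcomp Require Import convex.

Set Implicit Arguments.
Unset Strict Implicit.
Unset Printing Implicit Defensive.

Import Order.TTheory GRing.Theory Num.Theory.

Local Open Scope classical_set_scope.
Local Open Scope ring_scope.

Definition s_convex (R : realType) (d s : nat) (A : set 'rV[R]_d) : Prop :=
  exists k : nat, (k <= s)%N /\
    exists C : 'I_k -> set 'rV[R]_d,
      (forall j, convex_set (C j)) /\ A = \bigcup_j C j.

(* A finite family is indexed by an ordinal, so repeated members are allowed
   and counted with multiplicity; injective indexings are the sets of sets. *)
Definition colorful_tuple (m : nat) (n : 'I_m -> nat) : finType :=
  {dffun forall i : 'I_m, 'I_(n i)}.

Definition intersecting (R : realType) (d m : nat) (n : 'I_m -> nat)
    (F : forall i : 'I_m, 'I_(n i) -> set 'rV[R]_d)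
    (t : colorful_tuple n) : Prop :=
  (\bigcap_i F i (t i)) !=set0.

Definition num_intersecting (R : realType) (d m : nat) (n : 'I_m -> nat)
    (F : forall i : 'I_m, 'I_(n i) -> set 'rV[R]_d) : nat :=
  #|[pred t : colorful_tuple n | `[< intersecting F t >]]|.

Definition num_containing (R : realType) (d p : nat)
    (G : 'I_p -> set 'rV[R]_d) (x : 'rV[R]_d) : nat :=
  #|[pred j : 'I_p | `[< G j x >]]|.

(* Main.v *)
(* Pick a common point of each intersecting colorful tuple and, in every member
   of the tuple, a convex component containing it; replace each component by the
   convex hull of the picked points it received, so that it becomes compact.
   The point of least Euclidean norm in the intersection of the d+1 chosen hulls
   is, by Helly's theorem, already the point of least norm of some d of them.
   There are at most s^d * prod_(j != i) n_j choices of d components that miss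
   the i-th family, so by pigeonhole one such choice is shared by an
   alpha / ((d+1) s^d) fraction of the members of some family, and these members
   all contain its point of least norm. *)

Require Import Defs.
From mathcomp Require Import all_boot all_order all_algebra.
From mathcomp Require Import all_classical all_reals.
From mathcomp Require Import topology function_spaces normedtype derive convex.
From mathcomp Require Import interval_inference ring lra.

Set Implicit Arguments.
Unset Strict Implicit.
Unset Printing Implicit Defensive.

Import Order.TTheory GRing.Theory Num.Theory.
Import numFieldNormedType.Exports.

Local Open Scope classical_set_scope.
Local Open Scope ring_scope.

(** * Convex combinations and Helly's theorem *)

Lemma convex_setP (R : realFieldType) (M : lmodType R) (A : set M) :
  convex_set A <->
  forall x y t, 0 <= t <= 1 -> A x -> A y -> A (t *: x + (1 - t) *: y).
Proof.
split=> [cA x y t t01 Ax Ay|cA x y l /set_mem Ax /set_mem Ay].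
  have t01' : Itv.spec (@Itv.num_sem R) (Itv.Real `[0%Z, 1%Z]) t.
    by apply/and3P; split=> //; rewrite ?ger0_real //; case/andP: t01.
  exact: (set_mem (cA x y (Itv.mk t01') (mem_set Ax) (mem_set Ay))).
by apply/mem_set/cA => //; rewrite ge0 le1.
Qed.

(** The weights stay unnormalised so that the induction need not rescale them; nonemptiness of [A]
    provides [y] for the empty sum. *)
Lemma convex_set_sum (R : realFieldType) (M : lmodType R) (A : set M)
    (I : Type) (r : seq I) (P : pred I) (t : I -> R) (x : I -> M) :
  convex_set A -> A !=set0 -> (forall i, P i -> 0 <= t i) ->
  (forall i, P i -> A (x i)) ->
  exists2 y, A y &
    \sum_(i <- r | P i) t i *: x i = (\sum_(i <- r | P i) t i) *: y.
Proof.
move=> /convex_setP cA [y0 Ay0] t0 Ax.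
elim: r => [|i r [y Ay IH]]; first by exists y0; rewrite // !big_nil scale0r.
rewrite !big_cons; case: ifP => [Pi|_]; last by exists y.
have S0 : 0 <= \sum_(j <- r | P j) t j by apply: sumr_ge0.
rewrite {}IH; move: S0 (t0 i Pi); set S := \sum_(j <- r | P j) t j => S0 ti0.
have [/eqP|tS] := eqVneq (t i + S) 0.
  rewrite paddr_eq0 // => /andP[/eqP-> /eqP->].
  by exists y; rewrite // !addr0 !scale0r addr0.
have tSp : 0 < t i + S by rewrite lt_neqAle eq_sym tS addr_ge0.
exists ((t i / (t i + S)) *: x i + (1 - t i / (t i + S)) *: y).
  apply: cA => //; last exact: Ax.
  by rewrite divr_ge0 ?addr_ge0 //= ler_pdivrMr // mul1r lerDl.
by rewrite scalerDr !scalerA; congr (_ *: _ + _ *: _); field.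
Qed.

(** Radon's argument: an affine dependence among the d+2 points [p i] splits them into two groups
    whose hulls share a point [z], and [z] lies in every [A j]. *)
Lemma helly (R : realType) (d : nat) (A : 'I_d.+2 -> set 'rV[R]_d) :
  (forall i, convex_set (A i)) ->
  (forall i, exists p, forall j, j != i -> A j p) -> (\bigcap_i A i) !=set0.
Proof.
move=> cA /choice[p Ap].
(* The column of ones forces the coefficients of a dependence to sum to zero; d+2 rows of length d+1
   are dependent. *)
pose M : 'M[R]_(d.+2, d + 1) := \matrix_i row_mx (p i) (const_mx 1).
have [u uM u0] : exists2 u : 'rV[R]_d.+2, u *m M = 0 & u != 0.
  have : kermx M != 0.
    rewrite kermx_eq0 /row_free neq_ltn.
    by rewrite (leq_ltn_trans (rank_leq_col _)) ?addn1.
  by case/rowV0Pn => u /sub_kermxP; exists u.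
have uE k : \sum_i u 0 i * M i k = 0.
  by have := congr1 (fun v : 'rV_ _ => v 0 k) uM; rewrite !mxE.
have sum_u : \sum_i u 0 i = 0.
  rewrite -[RHS](uE (rshift d 0)); apply: eq_bigr => i _.
  by rewrite mxE row_mxEr mxE mulr1.
have sum_up : \sum_i u 0 i *: p i = 0.
  apply/rowP => k; rewrite summxE [RHS]mxE -[RHS](uE (lshift 1 k)).
  by apply: eq_bigr => i _; rewrite [in RHS]mxE row_mxEl mxE.
pose S := \sum_(i | 0 < u 0 i) u 0 i.
have SN : \sum_(i | ~~ (0 < u 0 i)) - u 0 i = S.
  move: sum_u; rewrite (bigID (fun i => 0 < u 0 i)) /= sumrN => /eqP.
  by rewrite addr_eq0 => /eqP <-.
have S_gt0 : 0 < S.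
  have S0 : 0 <= S by apply: sumr_ge0 => i /ltW.
  rewrite lt_neqAle S0 andbT eq_sym; apply: contra u0 => /eqP SZ.
  apply/eqP/rowP => i; rewrite mxE; case: (ltrP 0 (u 0 i)) => [ui|ui].
    move: SZ => /eqP; rewrite /S psumr_eq0 => [|j /ltW //].
    by move=> /allP/(_ i (mem_index_enum _)); rewrite ui => /eqP.
  move: SN; rewrite SZ => /eqP; rewrite psumr_eq0 => [|j]; last first.
    by rewrite -leNgt oppr_ge0.
  move=> /allP/(_ i (mem_index_enum _)).
  by rewrite -leNgt ui oppr_eq0 => /eqP.
pose z := S^-1 *: \sum_(i | 0 < u 0 i) u 0 i *: p i.
have zN : z = S^-1 *: \sum_(i | ~~ (0 < u 0 i)) - u 0 i *: p i.
  move: sum_up; rewrite (bigID (fun i => 0 < u 0 i)) /= /z => /eqP.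
  rewrite addr_eq0 => /eqP->; congr (_ *: _).
  by rewrite -sumrN; apply: eq_bigr => i _; rewrite scaleNr.
(* If [j] is outside [P], all points [p i] with [P i] lie in [A j], hence so does their weighted
   mean. *)
have side (P : pred 'I_d.+2) (t : 'I_d.+2 -> R) j : ~~ P j ->
    (forall i, P i -> 0 <= t i) -> \sum_(i | P i) t i = S ->
    A j (S^-1 *: \sum_(i | P i) t i *: p i).
  move=> Pj t0 tS.
  have Ajp i : P i -> A j (p i).
    by move=> Pi; apply: Ap; apply: contraNneq Pj => ->.
  have Aj0 : A j !=set0.
    case: (pickP P) => [i Pi|P0]; first by exists (p i); apply: Ajp.
    by move: S_gt0; rewrite -tS big_pred0 // ltxx.
  have [y Ay ->] := convex_set_sum (index_enum _) (cA j) Aj0 t0 Ajp.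
  by rewrite tS scalerA mulVf ?scale1r // gt_eqF.
(* Of the two expressions for [z], take the one whose group omits [j]. *)
exists z => j _; case: (boolP (0 < u 0 j)) => uj.
  rewrite zN; apply: side; rewrite ?negbK // => i.
  by rewrite -leNgt oppr_ge0.
by apply: side => // i /ltW.
Qed.

(** * The point of least Euclidean norm *)

Definition sqnorm (R : realType) (d : nat) (x : 'rV[R]_d) : R :=
  \sum_i x 0 i ^+ 2.

Lemma sqnorm_ge0 (R : realType) (d : nat) (x : 'rV[R]_d) : 0 <= sqnorm x.
Proof. by apply: sumr_ge0 => i _; exact: sqr_ge0. Qed.

Lemma sqnorm_eq0 (R : realType) (d : nat) (x : 'rV[R]_d) :
  sqnorm x = 0 -> x = 0.
Proof.
move=> /eqP; rewrite psumr_eq0 => [/allP x0|i _]; last exact: sqr_ge0.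
apply/rowP => i; rewrite mxE; apply/eqP.
by rewrite -(sqrf_eq0 (x 0 i)) (implyP (x0 i _)).
Qed.

(** The subtracted term expresses strict convexity, which makes the point of least norm unique. *)
Lemma sqnorm_conv (R : realType) (d : nat) (x y : 'rV[R]_d) (t : R) :
  sqnorm (t *: x + (1 - t) *: y) =
  t * sqnorm x + (1 - t) * sqnorm y - t * (1 - t) * sqnorm (x - y).
Proof.
rewrite /sqnorm !mulr_sumr -big_split -sumrB /=.
by apply: eq_bigr => i _; rewrite !mxE; ring.
Qed.

Lemma convex_set_ball (R : realType) (d : nat) (r : R) :
  convex_set [set x : 'rV[R]_d | sqnorm x < r].
Proof.
apply/convex_setP => x y t /andP[t0 t1] /= xr yr; rewrite sqnorm_conv.
have := sqnorm_ge0 (x - y); have : 0 <= 1 - t by rewrite subr_ge0.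
move: (sqnorm _) (sqnorm x) (sqnorm y) xr yr => D X Y xr yr t1' D0.
have : 0 <= t * (1 - t) * D by rewrite !mulr_ge0.
have [->|tn0] := eqVneq t 0; first by lra.
have tp : 0 < t by rewrite lt_neqAle eq_sym tn0.
by nra.
Qed.

Definition nearest (R : realType) (d : nat) (A : set 'rV[R]_d) : set 'rV[R]_d :=
  [set p | A p /\ forall y, A y -> sqnorm p <= sqnorm y].

Lemma nearest_unique (R : realType) (d : nat) (A : set 'rV[R]_d) p q :
  convex_set A -> nearest A p -> nearest A q -> p = q.
Proof.
move=> /convex_setP cA [Ap minp] [Aq minq].
have half : 0 <= (2^-1 : R) <= 1.
  by rewrite invr_ge0 ler0n invf_le1 ?ltr0n ?ler1n.
(* At the midpoint the squared norm drops by a quarter of [sqnorm (p - q)], so minimality forces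
   that to vanish. *)
have := minp _ (cA _ _ _ half Ap Aq); rewrite sqnorm_conv.
have := minp _ Aq; have := minq _ Ap; have D0 := sqnorm_ge0 (p - q).
move=> h1 h2 h3; apply/eqP; rewrite -subr_eq0; apply/eqP/sqnorm_eq0.
by apply/eqP; rewrite eq_le D0 andbT; lra.
Qed.

Lemma continuous_sqnorm (R : realType) (d : nat) :
  continuous (@sqnorm R d).
Proof.
apply: (continuous_big (@add_continuous _)) => i _ x.
have xi : (y 0 i) @[y --> x] --> x 0 i by exact: coord_continuous.
rewrite /continuous_at expr2; under eq_cvg do rewrite expr2.
exact: (cvgM xi xi).
Qed.

Lemma nearest_exists (R : realType) (d : nat) (A : set 'rV[R]_d) :
  compact A -> A !=set0 -> nearest A !=set0.
Proof.
move=> cA A0; have [|p /set_mem Ap minp] := EVT_min_rV A0 cA (f := @sqnorm R d).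
  exact/continuous_subspaceT/continuous_sqnorm.
by exists p; split=> // y /mem_set/minp.
Qed.

(* Helly's theorem for the d+1 sets and the open ball of radius |p| about 0. *)
Lemma nearest_bigcap (R : realType) (d : nat) (A : 'I_d.+1 -> set 'rV[R]_d) p :
  (forall i, convex_set (A i)) -> nearest (\bigcap_i A i) p ->
  exists i, nearest (\bigcap_j A (lift i j)) p.
Proof.
move=> cA [Ap minp]; apply: contrapT => noti.
(* If [p] is no longer nearest once [A i] is omitted, some point of the remaining sets beats it. *)
have closer i : exists y, sqnorm y < sqnorm p /\ forall j, j != i -> A j y.
  apply: contrapT => noy; apply: noti; exists i; split=> [j _|y Ay].
    exact: Ap.
  rewrite leNgt; apply/negP => yp; apply: noy; exists y; split=> // j.
  by rewrite eq_sym => /unlift_some[k -> _]; apply: Ay.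
have {closer}[y yP] := choice closer.
pose B (i : 'I_d.+2) : set 'rV[R]_d :=
  if unlift ord0 i is Some j then A j else [set x | sqnorm x < sqnorm p].
have [||z Bz] := @helly R d B.
- move=> i; rewrite /B; case: unlift => [j|]; first exact: cA.
  exact: convex_set_ball.
(* Index 0 of [B] is the ball: omitting it leaves the witness [p]; omitting [A j] leaves [y j],
   which is in the ball. *)
- move=> i; exists (if unlift ord0 i is Some j then y j else p) => j.
  rewrite /B; case: (unliftP ord0 i) => [i' ->|->];
    case: (unliftP ord0 j) => [j' ->|->] //.
  + by move=> ij; apply: (yP i').2; apply: contraNneq ij => ->.
  + by move=> _; exact: (yP i').1.
  + by move=> _; exact: Ap.
- have : B ord0 z by exact: Bz.
  rewrite /B unlift_none /= ltNge => /negP; apply; apply: minp => j _.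
  by have := Bz (lift ord0 j) I; rewrite /B liftK.
Qed.

(** * Compact hulls of finitely many points *)

Definition simplex (R : realType) (k : nat) : set 'rV[R]_k :=
  [set t | (forall i, 0 <= t 0 i) /\ \sum_i t 0 i = 1].

(** The generating points are the rows of [P]. As a linear image of the simplex the hull inherits
    compactness; for [k = 0] it is empty. *)
Definition hull (R : realType) (k d : nat) (P : 'M[R]_(k, d)) : set 'rV[R]_d :=
  [set t *m P | t in @simplex R k].

(** The simplex is closed in the unit cube, since nonnegative coordinates of sum 1 are at most 1. *)
Lemma simplex_compact (R : realType) (k : nat) : compact (@simplex R k).
Proof.
apply: (@subclosed_compact _ _
  [set t : 'rV[R]_k | forall i, `[0, 1]%classic (t 0 i)]); last first.
- move=> t [t0 t1] i /=; rewrite in_itv /= t0 -t1 (bigD1 i) //= lerDl.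
  exact: sumr_ge0.
- apply: (@rV_compact R k (fun=> `[0, 1]%classic : set R)) => _.
  exact: segment_compact.
- rewrite (_ : @simplex R k =
    (\bigcap_i [set t : 'rV[R]_k | 0 <= t 0 i]) `&`
    [set t : 'rV[R]_k | \sum_i t 0 i = 1]).
    apply: closedI.
      apply: closed_bigI => i _.
      apply: (@preimage_closed _ _ (fun t : 'rV[R]_k => t 0 i)
        [set x | 0 <= x]).
        by move=> t _; exact: coord_continuous.
      exact: closed_ge.
    apply: (@preimage_closed _ _ (fun t : 'rV[R]_k => \sum_i t 0 i)
      [set x | x = 1]).
      move=> t _; apply: (continuous_big (@add_continuous _)) => i _.
      exact: coord_continuous.
    exact: closed_eq.
  by apply/seteqP; split=> [t [t0 t1]|t [t0 t1]]; split=> // i;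
    [move=> _|]; exact: t0.
Qed.

Lemma hull_compact (R : realType) (k d : nat) (P : 'M[R]_(k, d)) :
  compact (hull P).
Proof.
apply: continuous_compact (@simplex_compact R k).
have -> : mulmx^~ P = fun t : 'rV_k => \sum_i t 0 i *: row i P.
  by apply/funext => t; exact: mulmx_sum_row.
apply: continuous_subspaceT.
apply: (continuous_big (@add_continuous _)) => i _ t.
have ti : (y 0 i) @[y --> t] --> t 0 i by exact: coord_continuous.
exact: (cvgZr_tmp ti).
Qed.

Lemma convex_set_hull (R : realType) (k d : nat) (P : 'M[R]_(k, d)) :
  convex_set (hull P).
Proof.
apply/convex_setP => _ _ a /andP[a0 a1] [t [t0 t1] <-] [u [u0 u1] <-].
exists (a *: t + (1 - a) *: u); last by rewrite mulmxDl !scalemxAl.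
split=> [i|]; first by rewrite !mxE addr_ge0 // mulr_ge0 // subr_ge0.
under eq_bigr do rewrite !mxE.
by rewrite big_split /= -!mulr_sumr t1 u1; ring.
Qed.

Lemma row_hull (R : realType) (k d : nat) (P : 'M[R]_(k, d)) i :
  hull P (row i P).
Proof.
exists (delta_mx 0 i); last by rewrite rowE.
split=> [j|]; first by rewrite mxE ler0n.
rewrite (bigD1 i) //= mxE !eqxx big1 ?addr0 // => j /negPf ji.
by rewrite mxE ji andbF.
Qed.

Lemma hull_sub (R : realType) (k d : nat) (P : 'M[R]_(k, d)) A :
  convex_set A -> (forall i, A (row i P)) -> hull P `<=` A.
Proof.
move=> cA AP _ [t [t0 t1] <-]; rewrite mulmx_sum_row.
have A0 : A !=set0.
  case: k P t AP t0 t1 => [P t _ _|k P t AP _ _]; last by exists (row 0 P).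
  by rewrite big_ord0 => /eqP; rewrite eq_sym oner_eq0.
have [y Ay ->] := convex_set_sum (index_enum _) cA A0
  (fun i (_ : xpredT i) => t0 i) (fun i _ => AP i).
by rewrite t1 scale1r.
Qed.

(** * Stability under intersection *)

Lemma convex_set_bigcap (R : realFieldType) (M : lmodType R) (I : Type)
    (D : set I) (A : I -> set M) :
  (forall i, convex_set (A i)) -> convex_set (\bigcap_(i in D) A i).
Proof.
move=> cA; apply/convex_setP => x y t t01 Ax Ay i Di.
have /convex_setP := cA i; apply=> //; [exact: Ax|exact: Ay].
Qed.

Lemma compact_bigcap (T : topologicalType) (I : Type) (i0 : I)
    (A : I -> set T) :
  hausdorff_space T -> (forall i, compact (A i)) -> compact (\bigcap_i A i).
Proof.
move=> hT cA; apply: (subclosed_compact _ (cA i0)); last by move=> x; apply.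
by apply: closed_bigI => i _; exact: compact_closed.
Qed.

(** * Counting by pigeonhole *)

Lemma card_partial_tuple (d s : nat) (m : 'I_d -> nat) :
  #|{dffun forall j, 'I_(m j) * 'I_s}| = (s ^ d * \prod_j m j)%N.
Proof.
rewrite card_dep_ffun foldrE big_map big_enum /=.
under eq_bigr do rewrite card_prod !card_ord mulnC.
by rewrite big_split /= prod_nat_const card_ord.
Qed.

Lemma sum_nat_pigeonhole (I : finType) (i0 : I) (f : I -> nat) :
  exists i, (\sum_j f j <= #|I| * f i)%N.
Proof.
case: (@arg_maxnP I i0 xpredT f isT) => i _ maxi; exists i.
by rewrite -sum_nat_const leq_sum.
Qed.

(** Each tuple in [T] has a least-norm point determined by its components outside some family i.
    Pigeonhole on i, then on those components, leaves many tuples that share this point and differ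
    only in their i-th member. *)
Lemma card_le_nearest (R : realType) (d s : nat) (n : 'I_d.+1 -> nat)
    (H : forall i, 'I_(n i) -> 'I_s -> set 'rV[R]_d)
    (T : pred (colorful_tuple n))
    (c : colorful_tuple n -> 'I_d.+1 -> 'I_s) :
  (forall i j a, convex_set (H i j a)) ->
  (forall i j a, compact (H i j a)) ->
  (forall t, T t -> (\bigcap_i H i (t i) (c t i)) !=set0) ->
  exists i x, (#|T| * n i <=
    d.+1 * s ^ d * (\prod_j n j) *
    #|[pred j : 'I_(n i) | `[< exists a, H i j a x >]]|)%N.
Proof.
move=> cH kH HT.
have /choice[g gP] : forall t : colorful_tuple n,
    exists ip : 'I_d.+1 * 'rV[R]_d, T t ->
    (\bigcap_i H i (t i) (c t i)) ip.2 /\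
    nearest (\bigcap_j H _ (t (lift ip.1 j)) (c t (lift ip.1 j))) ip.2.
  move=> t.
  have [/HT Ht|] := boolP (T t); last by exists (ord0, 0).
  have [|p near_p] := nearest_exists _ Ht.
    by apply: (compact_bigcap ord0) => // ; exact: norm_hausdorff.
  have [i near_ip] := nearest_bigcap (fun i => cH _ _ _) near_p.
  by exists (i, p) => _; split=> //; exact: near_p.1.
pose K i : finType := {dffun forall j, 'I_(n (lift i j)) * 'I_s}.
pose key i (t : colorful_tuple n) : K i :=
  finfun (fun j => (t (lift i j), c t (lift i j))).
pose Hkey i (k : K i) := \bigcap_j H _ (k j).1 (k j).2.
(* The point depends on the key alone, so it is common to a whole fiber. *)
pose q i (k : K i) := get (nearest (Hkey i k)).
pose fiber i (k : K i) := [pred t | (T t && ((g t).1 == i)) && (key i t == k)].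
pose N i x := #|[pred j : 'I_(n i) | `[< exists a, H i j a x >]]|.
(* The key fixes every member except the i-th, so [t i] is injective on a fiber. *)
have fiberN i k : (#|fiber i k| <= N i (q i k))%N.
  rewrite -(@card_in_image _ _ (fun t : colorful_tuple n => t i)); last first.
    move=> t t' /andP[_ /eqP <-] /andP[_ /eqP keyE] ti; apply/ffunP => j.
    case: (unliftP i j) => [j' ->|->] //.
    by have /(congr1 (fun f : K i => (f j').1)) := keyE; rewrite !ffunE.
  apply/subset_leq_card/fintype.subsetP => _ /fintype.imageP[t + ->].
  move=> /andP[/andP[Tt /eqP gi] /eqP <-] {k}.
  rewrite inE; exists (c t i).
  have [Hp near_p] := gP t Tt.
  (* Uniqueness of the nearest point identifies [q] with the point that [g] picked for [t], which
     lies in the i-th component too. *)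
  suff -> : q i (key i t) = (g t).2 by exact: (Hp i Logic.I).
  have near_p' : nearest (Hkey i (key i t)) (g t).2.
    move: near_p; rewrite gi /Hkey; congr (nearest _ _).
    by apply: eq_bigcapr => j _; rewrite ffunE.
  apply: nearest_unique (near_p'); first exact: convex_set_bigcap.
  exact: (getI near_p').
have cardT : #|T| = (\sum_i \sum_k #|fiber i k|)%N.
  rewrite -sum1_card (partition_big (fun t => (g t).1) xpredT) //=.
  apply: eq_bigr => i _; rewrite (partition_big (key i) xpredT) //=.
  apply: eq_bigr => k _; rewrite sum1_card.
  by apply: eq_card => t; rewrite !inE.
(* An empty [T] makes the bound trivial; otherwise [t0] supplies the key that shows [K i] to be
   inhabited. *)
have [T0|/card_gt0P[t0 _]] := posnP #|T|; first by exists ord0, 0; rewrite T0.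
have [i] := sum_nat_pigeonhole ord0 (fun i => \sum_k #|fiber i k|)%N.
rewrite -cardT card_ord => leT.
have [k leK] := sum_nat_pigeonhole (key i t0) (fun k => #|fiber i k|).
(* Splitting [n i] off the product leaves the factor that counts the keys. *)
exists i, (q i k); rewrite -/(N _ _) (bigD1_ord i) //=.
rewrite card_partial_tuple in leK.
have := leq_mul leT (leqnn (n i)) => /leq_trans; apply.
have := leq_trans leK (leq_mul (leqnn _) (fiberN i k)).
move: (bigop _ _ _) (N i _) => S M leM.
apply: leq_trans (leq_mul (leq_mul (leqnn d.+1) leM) (leqnn (n i))) _.
by apply: eq_leq; ring.
Qed.

(** * From s-convex members to compact components *)

(** Padding with empty sets gives exactly [s] components, so ['I_s] indexes the components of every
    member. *)
Lemma s_convex_indexed (R : realType) (d s : nat) (A : set 'rV[R]_d) :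
  s_convex s A -> exists C : 'I_s -> set 'rV[R]_d,
    (forall a, convex_set (C a)) /\ A = \bigcup_a C a.
Proof.
move=> [k [ks [C [cC ->]]]].
exists (fun a => if insub (val a) is Some b then C b else set0).
split=> [a|].
  by case: insub => // x y l; rewrite inE.
apply/seteqP; split=> x [a _ Cx].
  by exists (widen_ord ks a) => //=; rewrite valK.
by case: insubP Cx => // b _ _ Cx; exists b.
Qed.

Theorem theorem1p4 (R : realType) (d s : nat) (alpha : R)
    (n : 'I_d.+1 -> nat)
    (F : forall i : 'I_d.+1, 'I_(n i) -> set 'rV[R]_d)
    (d_ge1 : (1 <= d)%N) (s_ge1 : (1 <= s)%N) (alpha_gt0 : 0 < alpha)
    (n_gt0 : forall i, (0 < n i)%N)
    (F_s_convex : forall (i : 'I_d.+1) (j : 'I_(n i)), s_convex s (F i j))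
    (many_intersecting :
      alpha * \prod_(i < d.+1) (n i)%:R <= (num_intersecting F)%:R) :
  exists (i : 'I_d.+1) (x : 'rV[R]_d),
    alpha * (n i)%:R / (d.+1%:R * s%:R ^+ d) <= (num_containing (F i) x)%:R.
Proof.
pose C i j := sval (cid (s_convex_indexed (F_s_convex i j))).
have cC i j a : convex_set (C i j a).
  by rewrite /C; case: cid => ? [].
have FC i j : F i j = \bigcup_a C i j a.
  by rewrite /C; case: cid => ? [].
pose T := [pred t : colorful_tuple n | `[< intersecting F t >]].
have /choice[x xP] : forall t : colorful_tuple n, exists x, T t ->
    forall i, F i (t i) x.
  move=> t; have [/asboolP[x Fx]|] := boolP (T t); last by exists 0.
  by exists x => _ i; exact: Fx.
have /choice[c cP] : forall t : colorful_tuple n,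
    exists c : 'I_d.+1 -> 'I_s, T t -> forall i, C i (t i) (c i) (x t).
  move=> t; have [Tt|] := boolP (T t); last by exists (fun=> Ordinal s_ge1).
  have /choice[c cP] : forall i, exists a, C i (t i) a (x t).
    by move=> i; have := xP t Tt i; rewrite FC => -[a _]; exists a.
  by exists c.
(* The tuples whose chosen point is assigned to component [a] of the member [F i j]; [H] is the hull
   of these points. *)
pose S i j a := [pred t | [&& T t, t i == j & c t i == a]].
pose H i j a : set 'rV[R]_d := hull (\matrix_(b < #|S i j a|) x (enum_val b)).
have HC i j a : H i j a `<=` C i j a.
  apply: hull_sub => [|b]; first exact: cC.
  rewrite rowK; have /and3P[Tt /eqP tj /eqP ca] := enum_valP b.
  by have := cP _ Tt i; rewrite tj ca.
have [|||i [p]] := @card_le_nearest R d s n H T c.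
- by move=> i j a; exact: convex_set_hull.
- by move=> i j a; exact: hull_compact.
(* The hulls still meet along [t]: [x t] is one of the generators of each. *)
- move=> t Tt; exists (x t) => i _.
  have St : t \in S i (t i) (c t i) by rewrite inE Tt !eqxx.
  have := @row_hull R _ d (\matrix_(b < #|S i (t i) (c t i)|) x (enum_val b))
    (enum_rank_in St t).
  by rewrite rowK enum_rankK_in.
set M := (X in (_ <= _ * X)%N) => leT.
have MN : (M <= num_containing (F i) p)%N.
  rewrite /M /num_containing.
  apply/subset_leq_card/fintype.subsetP => j; rewrite !inE => -[a Ha].
  by rewrite FC; exists a => //; exact: HC.
exists i, p; rewrite ler_pdivrMr ?mulr_gt0 ?exprn_gt0 ?ltr0n //.
apply: (@le_trans _ _ (M%:R * (d.+1%:R * s%:R ^+ d))); last first.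
  by rewrite ler_wpM2r ?ler_nat // mulr_ge0 // exprn_ge0.
have P_gt0 : 0 < \prod_(j < d.+1) (n j)%:R :> R.
  by apply: prodr_gt0 => j _; rewrite ltr0n.
(* Multiplying by the product of all [n j] lets [many_intersecting] bound the left side by [#|T|]
   times [n i], and [leT] finishes. *)
rewrite -(ler_pM2r P_gt0) mulrAC.
apply: (@le_trans _ _ (#|T|%:R * (n i)%:R)).
  by rewrite ler_wpM2r.
rewrite -natrX -natr_prod -!natrM ler_nat; apply: leq_trans leT _.
by apply: eq_leq; ring.
Qed.
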